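(* (i) Let $n \in \mathbb{N}$ and let $P_{2n}(z) = \sum_{k=0}^{2n} a_k z^k$ be a real polynomial with $a_k \in \mathbb{R}\setminus\{0\}$ for all $k=0,1,\ldots,2n$. Suppose that $|q_k(P_{2n})| \geq b_{2n}$ for all $k = 2, 3, \ldots, 2n$. Then all the zeros of $P_{2n}$ are real. (ii) For every $n \in \mathbb{N}$ and every $\varepsilon > 0$ there exists a real polynomial $P_{2n,\varepsilon}$ of degree $2n$ with all coefficients nonzero such that $|q_k(P_{2n,\varepsilon})| > b_{2n} - \varepsilon$ for all $k = 2, 3, \ldots, 2n$, and $P_{2n,\varepsilon}$ has nonreal roots. (iii) Let $n \in \mathbb{N}$ and let $P_{2n+1}(z) = \sum_{k=0}^{2n+1} a_k z^k$ be a real polynomial with $a_k \in \mathbb{R}\setminus\{0\}$ for all $k=0,1,\ldots,2n+1$. Suppose that $|q_k(P_{2n+1})| \geq b_{2n+2}$ for all $k = 2, 3, \ldots, 2n+1$. Then all the zeros of $P_{2n+1}$ are real. (iv) For every $n \in \mathbb{N}$ and every $\varepsilon > 0$ there exists a real polynomial $P_{2n+1,\varepsilon}$ of degree $2n+1$ with all coefficients nonzero such that $|q_k(P_{2n+1,\varepsilon})| > b_{2n} - \varepsilon$ for all $k = 2, 3, \ldots, 2n+1$, and $P_{2n+1,\varepsilon}$ has nonreal roots. (v) Let $P_3$ be a real polynomial of degree $3$ with all coefficients nonzero, and suppose that $|q_k(P_3)| \geq \sqrt{9+6\sqrt{3}}$ for $k = 2, 3$. Then all the zeros of $P_3$ are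 real. (vi) For every $\varepsilon > 0$ there exists a real polynomial $P_{3,\varepsilon}$ of degree $3$ with all coefficients nonzero such that $|q_k(P_{3,\varepsilon})| > \sqrt{9+6\sqrt{3}} - \varepsilon$ for $k = 2, 3$, and $P_{3,\varepsilon}$ has nonreal roots.
   Context: $\mathbb{N} = \{1, 2, 3, \ldots\}$. For a polynomial $P(z)=\sum_{k=0}^{m} a_k z^k$ of degree $m\ge 2$ with all coefficients $a_0,\ldots,a_m$ nonzero, the second quotients of its coefficients are $q_k(P) = \dfrac{a_{k-1}^2}{a_{k-2}a_k}$ for $2 \le k \le m$. For $n \in \mathbb{N}$, $b_{2n}$ denotes the unique positive root $x$ of the equation $1 - 2\sum_{k=1}^{n} x^{-k^2/2} = 0$ (e.g. $b_2 = 4$). *)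

(* Defs.v *)
From HB Require Import structures.
From mathcomp Require Import all_boot all_order all_algebra.
From mathcomp Require Import all_classical all_reals all_analysis.
From mathcomp Require Import complex.

Set Implicit Arguments.
Unset Strict Implicit.
Unset Printing Implicit Defensive.

Import Order.TTheory GRing.Theory Num.Theory.
Import numFieldTopology.Exports numFieldNormedType.Exports.

Local Open Scope classical_set_scope.
Local Open Scope ring_scope.

Section Definitions.
Variable R : realType.
Implicit Type P : {poly R}.

Definition full_poly (m : nat) P : Prop :=
  size P = m.+1 /\ forall k : nat, (k <= m)%N -> P`_k != 0.

(* Only meaningful for k >= 2, where the truncated predecessors k.-1 and k.-2
   are the honest k - 1 and k - 2. *)
Definition second_quotient P (k : nat) : R :=
  P`_(k.-1) ^+ 2 / (P`_(k.-2) * P`_k).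

Definition all_zeros_real P : Prop :=
  forall z : R[i], root (map_poly (real_complex R) P) z -> z \is Num.real.

Definition has_nonreal_zero P : Prop :=
  exists z : R[i], root (map_poly (real_complex R) P) z /\ z \isn't Num.real.

Definition b_eqn (n : nat) (x : R) : R :=
  1 - 2 * \sum_(1 <= k < n.+1) x `^ (- (k%:R ^+ 2 / 2)).

(* [b_even n] is b_{2n}; the choice is justified by [b_evenP] and
   [b_even_unique] below, and is meaningless for n = 0. *)
Definition b_even (n : nat) : R :=
  get [set x : R | 0 < x /\ b_eqn n x = 0].

Lemma b_eqn_lt (n : nat) (x y : R) :
  (0 < n)%N -> 0 < x -> x < y -> b_eqn n x < b_eqn n y.
Proof.
move=> n0 x0 xy; rewrite /b_eqn ltrD2l ltrN2 ltr_pM2l//.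
apply: ltr_sum_nat => // k /andP[k1 _].
have e0 : 0 < k%:R ^+ 2 / 2 :> R by rewrite divr_gt0// exprn_gt0// ltr0n.
have y0 : 0 < y by exact: lt_trans xy.
by rewrite !powRN ltf_pV2 ?posrE ?powR_gt0// gt0_ltr_powR ?nnegrE ?ltW.
Qed.

Lemma b_eqn_root_ex (n : nat) :
  (0 < n)%N -> exists x : R, 0 < x /\ b_eqn n x = 0.
Proof.
move=> n0.
have n1 : 1 <= 2 * n%:R :> R by rewrite -natrM ler1n muln_gt0.
set c : R := (2 * n%:R) ^+ 2.
have c1 : 1 <= c by rewrite exprn_ege1.
have fc : {within `[1, c], continuous (b_eqn n)}.
  apply: derivable_within_continuous => x; rewrite in_itv/= => /andP[x1 _].
  have x0 : 0 < x by exact: lt_le_trans x1.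
  apply: derivableB => //; apply: derivableM => //.
  rewrite (_ : (fun _ => _) =
    \sum_(1 <= k < n.+1) (fun x : R => x `^ (- (k%:R ^+ 2 / 2)))); last first.
    by apply/funext => t; rewrite fct_sumE.
  elim/big_ind : _ => // [f g fx gx|k _]; first exact: derivableD.
  by apply: derivable_powR; rewrite in_itv/= x0.
have f1 : b_eqn n 1 <= 0.
  rewrite /b_eqn subr_le0 (eq_bigr (fun=> 1)); last by move=> *; rewrite powR1.
  by rewrite sumr_const_nat subn1.
have f2 : 0 <= b_eqn n c.
  rewrite /b_eqn subr_ge0.
  have E : 2 * \sum_(1 <= k < n.+1) (2 * n%:R)^-1 = 1 :> R.
    rewrite sumr_const_nat subn1/= -[_ *+ n]mulr_natr mulrCA.
    by rewrite mulVf// gt_eqF// (lt_le_trans _ n1).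
  rewrite -[leRHS]E ler_pM2l//; apply: ler_sum_nat => k /andP[k1 _].
  rewrite (_ : (2 * n%:R)^-1 = c `^ (- 2^-1)).
    rewrite ler_powR// lerN2 -[leLHS]mul1r ler_pM2r// exprn_ege1// ler1n//.
  by rewrite powRN powR12_sqrt ?sqr_ge0// sqrtr_sqr ger0_norm// (le_trans _ n1).
have [|x] := IVT c1 fc (v := 0).
  by rewrite ge_min f1 le_max f2 orbT.
rewrite in_itv/= => /andP[x1 _] fx; exists x; split => //.
exact: lt_le_trans x1.
Qed.

Lemma b_evenP (n : nat) : (0 < n)%N -> 0 < b_even n /\ b_eqn n (b_even n) = 0.
Proof.
by move=> n0; exact: (@getPex _ [set x : R | _ /\ _] (b_eqn_root_ex n0)).
Qed.

Lemma b_even_unique (n : nat) (x : R) :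
  (0 < n)%N -> 0 < x -> b_eqn n x = 0 -> x = b_even n.
Proof.
move=> n0 x0 fx; have [b0 fb] := b_evenP n0.
by have [/(b_eqn_lt n0 x0)|/(b_eqn_lt n0 b0)|//] := ltgtP x (b_even n);
  rewrite fx fb ltxx.
Qed.

End Definitions.

(* Main.v *)
Require Import Defs.
From HB Require Import structures.
From mathcomp Require Import all_boot all_order all_algebra.
From mathcomp Require Import all_classical all_reals all_analysis.
From mathcomp Require Import complex.
From mathcomp Require Import ring lra zify.

Import Order.TTheory GRing.Theory Num.Theory.

Local Open Scope ring_scope.

(** Write [y = b^(-1/2)] and [S(n) = y + y^4 + ... + y^(n^2)].  If all second
    quotients are at least [b] in absolute value, then on the circle of radius
    [r_k = |a_(k-1) / a_k| / y] the term of degree [k +- j] is at most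
    [y^(j^2)] times the term of degree [k].  Since [S(k) + S(m - k)] is at most
    [2 S(n) = 1] for [m <= 2 n], the [k]-th term fixes the sign of [P] at [r_k] and [- r_k].
    Hence on the half-axis selected by the sign of [a_k a_(k+1)] there is a zero
    of absolute value between [r_k] and [r_(k+1)].  Equality can only occur for
    [k = n]; dropping one annulus there still leaves [m - 1] distinct
    real zeros, which forces the last zero to be real.

    For sharpness, take [|a_k| = y^((k-n)^2)] with [a_n] the only positive
    coefficient: by AM-GM [2 S(n) > 1] excludes positive zeros, while a
    polynomial with only real nonpositive zeros has coefficients of one sign.
    For cubics, the bound comes from the discriminant, and [1 - q X + q X^2 + X^3]
    with [q] slightly below it has no positive zero. *)

(** * Real and nonreal zeros of real polynomials *)

Lemma size_monic_quadratic (R : nzRingType) (p q : R) :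
  size ('X^2 + p *: 'X + q%:P) = 3%N.
Proof.
have hp : (size (p *: 'X)%R < size ('X^2 : {poly R})%R)%N.
  by rewrite size_polyXn (leq_ltn_trans (size_scale_leq _ _)) ?size_polyX.
have hq : (size q%:P < size ('X^2 + p *: 'X)%R)%N.
  by rewrite size_polyDl// size_polyXn (leq_ltn_trans (size_polyC_leq1 _)).
by rewrite size_polyDl// size_polyDl// size_polyXn.
Qed.

Lemma poly_size_le2 (R : nzRingType) (p : {poly R}) :
  (size p <= 2)%N -> p = p`_1 *: 'X + (p`_0)%:P.
Proof.
move=> sp; apply/polyP => -[|[|k]]; rewrite coefD coefZ coefX coefC /=.
- by rewrite mulr0 add0r.
- by rewrite mulr1 addr0.
- by rewrite mulr0 addr0 nth_default// (leq_trans sp).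
Qed.

(** The factor is the minimal polynomial of $z = a + ib$. The remainder of [P] modulo it has degree
    at most 1 and vanishes at [z]; its imaginary part there kills the slope since $b \ne 0$, and its
    real part then kills the constant. *)
Lemma nonreal_zero_factor (R : realType) (P : {poly R}) (z : R[i]) :
  root (map_poly (real_complex R) P) z -> z \isn't Num.real ->
  exists p q : R, p ^+ 2 < 4 * q /\ ('X^2 + p *: 'X + q%:P) %| P.
Proof.
case: z => a b; rewrite complex_real => rz b0.
set z := (a +i* b)%C in rz.
exists (- (2 * a)), (a ^+ 2 + b ^+ 2).
have b2 : 0 < b ^+ 2 by rewrite lt_def sqrf_eq0 b0 sqr_ge0.
split; first by rewrite sqrrN; nra.
set Q := _ + _.
have sQ : size Q = 3%N by exact: size_monic_quadratic.
have Qz : (map_poly (real_complex R) Q).[z] = 0.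
  have [q qE] : exists q, q = a ^+ 2 + b ^+ 2 by exists (a ^+ 2 + b ^+ 2).
  rewrite /Q -qE.
  rewrite !rmorphD /= map_polyXn map_polyZ map_polyX map_polyC /=.
  rewrite !hornerE /z expr2; simpc.
  by apply/eqP; rewrite eq_complex /= qE; apply/andP; split; apply/eqP; ring.
rewrite /dvdp; set r := P %% Q.
have sr : (size r <= 2)%N.
  by rewrite -ltnS -sQ ltn_modp -size_poly_gt0 sQ.
have : (map_poly (real_complex R) r).[z] = 0.
  move: rz; rewrite /root {1}(divp_eq P Q) rmorphD rmorphM /= hornerD hornerM.
  by rewrite Qz mulr0 add0r => /eqP.
rewrite (poly_size_le2 _ _ sr) rmorphD /= map_polyZ map_polyX map_polyC /= !hornerE /z; simpc.
move=> /eqP; rewrite eq_complex /= => /andP[/eqP e0 e1].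
move: e1; rewrite ?addr0 mulf_eq0 (negPf b0) orbF => /eqP r1.
by move: e0; rewrite r1 mul0r add0r => ->; rewrite scale0r add0r polyC_eq0.
Qed.

Lemma pos_quadratic_noroot (R : realType) (p q x : R) : p ^+ 2 < 4 * q ->
  ~~ root ('X^2 + p *: 'X + q%:P) x.
Proof.
move=> pq; rewrite /root !hornerE; apply/eqP => h.
have := sqr_ge0 (2 * x + p).
have -> : (2 * x + p) ^+ 2 = 4 * (x ^+ 2 + p * x + q) + (p ^+ 2 - 4 * q) by ring.
rewrite h; lra.
Qed.

(** A nonreal zero would split off a quadratic without real zeros, so all of [s] would be zeros of a
    nonzero quotient of degree less than [size s]. *)
Lemma all_zeros_real_of_roots (R : realType) (P : {poly R}) (s : seq R) :
  P != 0 -> uniq s -> all (root P) s -> (size P <= (size s).+2)%N ->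
  all_zeros_real P.
Proof.
move=> P0 us rs sP z rz; apply/negPn/negP => nz.
have [p [q [pq]]] := nonreal_zero_factor _ _ _ rz nz.
set Q := _ + _ => QP.
have sQ : size Q = 3%N by exact: size_monic_quadratic.
have Q0 : Q != 0 by rewrite -size_poly_gt0 sQ.
have S0 : P %/ Q != 0 by rewrite dvdp_div_eq0.
have rS : all (root (P %/ Q)) s.
  apply/allP => x /(allP rs); rewrite -{1}(divpK QP) rootM.
  by rewrite (negPf (pos_quadratic_noroot _ _ _ _ pq)) orbF.
have := max_poly_roots S0 rS us.
by rewrite size_divp// sQ /= ltn_subRL ltnNge sP.
Qed.

(** Up to the leading coefficient, [P] is a product of factors $X - z$ with $z \le 0$, and products
    preserve nonnegativity of coefficients. *)
Lemma coef_sign_of_real_zeros (R : realType) (P : {poly R}) (k : nat) :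
  all_zeros_real P -> (forall x : R, 0 < x -> ~~ root P x) ->
  0 <= lead_coef P * P`_k.
Proof.
move=> Pr Pn.
set PC := map_poly (real_complex R) P.
have [rs E] := closed_field_poly_normal PC.
have lE : lead_coef PC = (lead_coef P)%:C%C by rewrite lead_coef_map.
have [->|P0] := eqVneq P 0; first by rewrite coef0 mulr0.
have lP : lead_coef P != 0 by rewrite lead_coef_eq0.
have : 0 <= (\prod_(z <- rs) ('X - z%:P))`_k.
  rewrite big_seq; elim/big_ind : _ k => [k|p q p0 q0 k|z zrs k].
  - by rewrite coef1 ler0n.
  - by rewrite coefM sumr_ge0// => i _; rewrite mulr_ge0.
  have rz : root PC z.
    by rewrite E rootZ ?root_prod_XsubC// lE fmorph_eq0.
  have /complex_realP[x zx] := Pr _ rz.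
  have x0 : x <= 0.
    rewrite leNgt; apply/negP => /Pn/negP; apply.
    by rewrite -(fmorph_root (real_complex R)); move: rz; rewrite zx.
  rewrite coefB coefX coefC zx.
  case: k => [|[|k]] /=; rewrite ?sub0r ?subr0 ?ler01//.
  by rewrite -rmorphN /= ler0c oppr_ge0.
have -> : (\prod_(z <- rs) ('X - z%:P))`_k = (P`_k / lead_coef P)%:C%C.
  have : PC`_k = (P`_k)%:C%C by rewrite coef_map.
  rewrite E coefZ lE => h; apply: (mulfI (x := (lead_coef P)%:C%C)).
    by rewrite fmorph_eq0.
  by rewrite h -rmorphM /= mulrCA divff// mulr1.
rewrite ler0c => h.
have -> : lead_coef P * P`_k = lead_coef P ^+ 2 * (P`_k / lead_coef P) by field.
by rewrite mulr_ge0// sqr_ge0.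
Qed.

(** * Partial theta sums *)

Definition theta {R : realType} (y : R) (n : nat) : R :=
  \sum_(i < n) y ^+ (i.+1 ^ 2).

Section DominantTerm.
Context {R : realType}.
Implicit Types (P : {poly R}) (y : R).

Lemma theta_lt y m n : 0 < y -> (m < n)%N -> theta y m < theta y n.
Proof.
move=> y0 /subnKC <-; elim: (n - _)%N => [|d ih]; rewrite ?addn0 ?addnS /theta.
  by rewrite big_ord_recr /= ltrDl exprn_gt0.
by rewrite (lt_trans ih)// [ltRHS]big_ord_recr /= ltrDl exprn_gt0.
Qed.

(** The increments $y^{j^2}$ of [theta y] strictly decrease in $j$, so each step away from the
    centre loses more on the left than it gains on the right. *)
Lemma theta_concave y n d : 0 < y -> y < 1 -> (d < n)%N ->
  theta y (n - d.+1) + theta y (n + d.+1) < theta y n *+ 2.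
Proof.
move=> y0 y1; elim: d => [|d ih] dn.
  case: n dn => // n _; rewrite subn1 addn1 /= mulr2n /theta.
  rewrite !big_ord_recr /=.
  have : y ^+ (n.+2 ^ 2) < y ^+ (n.+1 ^ 2) by rewrite ltr_iXn2l// ltn_sqr.
  lra.
have := ih (ltnW dn); rewrite [(n + d.+2)%N]addnS /theta.
rewrite [X in _ -> _ + X < _]big_ord_recr /=.
have -> : (n - d.+1 = (n - d.+2).+1)%N by lia.
rewrite [X in X + _ < _ -> _]big_ord_recr /=.
have : y ^+ ((n + d.+1).+1 ^ 2) < y ^+ ((n - d.+2).+1 ^ 2).
  by rewrite ltr_iXn2l// ltn_sqr; lia.
lra.
Qed.

Lemma theta_balanced y n k : 0 < y -> y < 1 -> (k <= 2 * n)%N -> k != n ->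
  theta y k + theta y (2 * n - k) < theta y n *+ 2.
Proof.
move=> y0 y1 k2n; rewrite neq_ltn => /orP[kn|nk].
  have -> : k = (n - (n - k).-1.+1)%N by lia.
  have -> : (2 * n - (n - (n - k).-1.+1) = n + (n - k).-1.+1)%N by lia.
  by apply: theta_concave => //; lia.
have -> : k = (n + (k - n).-1.+1)%N by lia.
have -> : (2 * n - (n + (k - n).-1.+1) = n - (k - n).-1.+1)%N by lia.
by rewrite addrC; apply: theta_concave => //; lia.
Qed.

(* The radius at which the [k]-th term of [P] is [y^-1] times the
   [k.-1]-st one; it vanishes at [k = 0] by convention. *)
Definition radius P y (k : nat) : R :=
  if k is k'.+1 then `|P`_k'| / `|P`_k| / y else 0.

(** * Size of the terms on the circles of radius [radius P y k] *)

Variables (P : {poly R}) (y : R) (m : nat).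
Hypotheses (y0 : 0 < y) (y1 : y < 1) (Pm : full_poly m P).
Hypothesis Pq : forall k, (2 <= k <= m)%N -> 1 <= y ^+ 2 * `|second_quotient P k|.

Let a0 k : (k <= m)%N -> 0 < `|P`_k|.
Proof. by move=> km; rewrite normr_gt0; case: Pm => _; apply. Qed.

(** The second quotient of index $k$ has absolute value $d_k / d_{k-1}$, so [Pq] says that [d] grows
    by a factor of at least $y^{-2}$ per step. *)
Let d k := `|P`_k.-1| / `|P`_k|.

Let d_gt0 k : (0 < k <= m)%N -> 0 < d k.
Proof. by move=> km; rewrite divr_gt0 ?a0//; lia. Qed.

Let radiusS k : radius P y k.+1 = d k.+1 / y. Proof. by []. Qed.

Let radius_gt0 k : (0 < k <= m)%N -> 0 < radius P y k.
Proof. by case: k => // k km; rewrite radiusS divr_gt0 ?d_gt0. Qed.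

Let radius_ge0 k : (k <= m)%N -> 0 <= radius P y k.
Proof. by case: k => // k km; rewrite ltW ?radius_gt0. Qed.

Let dS k : (0 < k < m)%N -> d k <= y ^+ 2 * d k.+1.
Proof.
case: k => // k km; have /Pq : (2 <= k.+2 <= m)%N by lia.
rewrite /second_quotient /d /= normrM normrX normfV normrM.
have : 0 < `|P`_k| by apply: a0; lia.
have : 0 < `|P`_k.+1| by apply: a0; lia.
have : 0 < `|P`_k.+2| by apply: a0; lia.
move: `|P`_k| `|P`_k.+1| `|P`_k.+2| => a b c c_gt0 b_gt0 a_gt0 h.
rewrite -[leLHS]mulr1 (le_trans (ler_wpM2l _ h))//; first by rewrite divr_ge0 // ltW.
by rewrite le_eqVlt; apply/orP; left; apply/eqP; field; rewrite !gt_eqF.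
Qed.

Let dD k j : (0 < k)%N -> (k + j <= m)%N -> d k <= y ^+ (2 * j) * d (k + j).
Proof.
move=> k_gt0; elim: j => [|j ih] kj; first by rewrite addn0 mul1r.
rewrite (le_trans (ih _))//; first by lia.
rewrite mulnSr exprD -mulrA ler_wpM2l ?exprn_ge0 ?(ltW y0)// addnS dS//; lia.
Qed.

(** Lowering the index from $k - j$ to $k - j - 1$ multiplies the coefficient by $d_{k-j} \le y^{2j}
    d_k$, which is $y^{2j+1}$ times the radius; the odd exponents add up to $j^2$. *)
Lemma left_term_le k j : (0 < k <= m)%N -> (j <= k)%N ->
  `|P`_(k - j)| <= `|P`_k| * radius P y k ^+ j * y ^+ (j ^ 2).
Proof.
move=> km; elim: j => [|j ih] jk; first by rewrite subn0 !mulr1.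
have e : `|P`_(k - j.+1)| = d (k - j) * `|P`_(k - j)|.
  rewrite /d divfK ?gt_eqF ?a0//; last by lia.
  by congr (`| P`_ _|); lia.
rewrite e.
have -> : (j.+1 ^ 2 = 2 * j + 1 + j ^ 2)%N by lia.
have h : d (k - j) <= radius P y k * y ^+ (2 * j + 1).
  have /dD : (0 < k - j)%N by lia.
  move=> /(_ j); rewrite subnK; last by lia.
  move=> /(_ _) /le_trans; apply; first by lia.
  case: k km {ih jk e} => // k km; rewrite radiusS exprD.
  by rewrite le_eqVlt; apply/orP; left; apply/eqP; field; rewrite gt_eqF.
rewrite (le_trans (ler_pM _ _ h (ih _)))//; [|by lia|].
  by rewrite ltW// d_gt0//; lia.
by rewrite le_eqVlt; apply/orP; left; apply/eqP; rewrite exprSr !exprD; ring.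
Qed.

Lemma right_term_le k j : (0 < k)%N -> (k + j <= m)%N ->
  `|P`_(k + j)| * radius P y k ^+ j <= `|P`_k| * y ^+ (j ^ 2).
Proof.
move=> k_gt0; elim: j => [|j ih] jk; first by rewrite addn0.
have d1 : 0 < d (k + j.+1) by apply: d_gt0; lia.
have e : `|P`_(k + j.+1)| = `|P`_(k + j)| / d (k + j.+1).
  by rewrite /d addnS /= invf_div mulrC divfK// gt_eqF// a0//; lia.
rewrite e.
have -> : (j.+1 ^ 2 = 2 * j + 1 + j ^ 2)%N by lia.
have h : radius P y k / d (k + j.+1) <= y ^+ (2 * j + 1).
  rewrite ler_pdivrMr//.
  have := dD _ _ k_gt0 jk.
  case: k k_gt0 {ih jk e d1} => // k _ h; rewrite radiusS ler_pdivrMr//.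
  rewrite (le_trans h)// le_eqVlt; apply/orP; left; apply/eqP.
  by rewrite mulnSr !exprD; ring.
rewrite exprSr [leLHS](_ : _ = `|P`_(k + j)| * radius P y k ^+ j *
    (radius P y k / d (k + j.+1))); last by ring.
rewrite exprD [leRHS](_ : _ = `|P`_k| * y ^+ (j ^ 2) * y ^+ (2 * j + 1)); last by ring.
have rk : 0 <= radius P y k by rewrite radius_ge0//; lia.
apply: ler_pM => //; first by rewrite mulr_ge0// exprn_ge0.
  by rewrite divr_ge0// ltW.
by apply: ih; lia.
Qed.

Lemma dominant_term k x : (0 < k <= m)%N -> `|x| = radius P y k ->
  `|P.[x] - P`_k * x ^+ k| <=
    `|P`_k * x ^+ k| * (theta y k + theta y (m - k)).
Proof.
move=> km xr; have r0 : 0 <= radius P y k by rewrite radius_ge0; lia.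
case: Pm => sP _.
have -> : P.[x] - P`_k * x ^+ k = \sum_(0 <= i < k) P`_i * x ^+ i +
    \sum_(0 <= i < m - k) P`_(k + i.+1) * x ^+ (k + i.+1).
  rewrite horner_coef sP -(big_mkord xpredT (fun i => P`_i * x ^+ i)).
  rewrite (@big_cat_nat _ _ _ k)//=; [|by lia].
  rewrite [X in _ + X - _]big_ltn; [|by lia].
  rewrite addrCA [_ * _ + _]addrC addrK; congr (_ + _).
  rewrite -[k.+1]add0n big_addn subSS; apply: eq_bigr => i _.
  by rewrite addnC addSnnS.
rewrite normrM normrX xr mulrDr.
rewrite (le_trans (ler_normD _ _))// lerD//.
  rewrite big_mkord (le_trans (ler_norm_sum _ _ _))// /theta mulr_sumr.
  rewrite (reindex_inj rev_ord_inj) /=; apply: ler_sum => i _.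
  have ik : (i < k)%N by [].
  rewrite normrM normrX xr.
  rewrite (le_trans (ler_wpM2r _ (left_term_le _ _ km ik)))// ?exprn_ge0//.
  have e : radius P y k ^+ k = radius P y k ^+ (k - i.+1) * radius P y k ^+ i.+1.
    by rewrite -exprD subnK.
  by rewrite e le_eqVlt; apply/orP; left; apply/eqP; ring.
rewrite big_mkord (le_trans (ler_norm_sum _ _ _))// /theta mulr_sumr.
apply: ler_sum => i _; rewrite normrM normrX xr exprD mulrCA mulrC.
rewrite [leRHS]mulrAC ler_wpM2r ?exprn_ge0// right_term_le//; first by lia.
by have := ltn_ord i; lia.
Qed.

(** The other terms together do not exceed the [k]-th one. For [k = 0] the radius is 0, so [x = 0]
    and the product is the square of the constant coefficient. *)
Lemma sign_at_radius k x : (k <= m)%N -> `|x| = radius P y k ->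
  ((0 < k)%N -> theta y k + theta y (m - k) <= 1) ->
  0 <= P`_k * x ^+ k * P.[x].
Proof.
case: k => [|k] km xr th.
  by move/normr0_eq0: xr => ->; rewrite mulr1 horner_coef0 -expr2 sqr_ge0.
have /dominant_term/(_ xr) : (0 < k.+1 <= m)%N by [].
set A := P`_ _ * _; set S := theta _ _ + _ => h.
have {}h : `|P.[x] - A| <= `|A| by rewrite (le_trans h)// ler_piMr// th.
rewrite mulrC.
have [A0|A0] := leP 0 A.
  rewrite mulr_ge0//; move: h; rewrite (ger0_norm A0) ler_norml => /andP[]; lra.
rewrite mulr_le0 ?(ltW A0)//; move: h; rewrite (ltr0_norm A0) ler_norml => /andP[]; lra.
Qed.

Lemma nonzero_at_radius k x : (k <= m)%N -> `|x| = radius P y k ->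
  ((0 < k)%N -> theta y k + theta y (m - k) < 1) -> ~~ root P x.
Proof.
case: k => [|k] km xr th.
  by move/normr0_eq0: xr => ->; rewrite rootE horner_coef0 -normr_gt0 a0.
have /dominant_term/(_ xr) : (0 < k.+1 <= m)%N by [].
apply: contraTN => /rootP ->; rewrite sub0r normrN -ltNge gtr_pMr ?th//.
by rewrite normrM normrX xr mulr_gt0 ?a0 ?exprn_gt0 ?radius_gt0.
Qed.

Lemma radius_le k : (k < m)%N -> radius P y k <= radius P y k.+1.
Proof.
case: k => [|k] km; first by rewrite radius_ge0.
rewrite !radiusS ler_pM2r ?invr_gt0//.
have /dS/le_trans : (0 < k.+1 < m)%N by []; apply.
by rewrite ler_piMl ?exprn_ile1 ?ltW// d_gt0.
Qed.

(** * One real zero per closed annulus, and counting them *)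

Lemma annulus_zero k : (k < m)%N ->
  (forall i, (0 < i <= m)%N -> theta y i + theta y (m - i) <= 1) ->
  exists x, radius P y k <= `|x| <= radius P y k.+1 /\ root P x.
Proof.
(* The sign [s] selects the half-axis on which the terms of degrees [k] and [k.+1] have opposite
   signs, since their product carries $s^{2k+1} = s$. *)
move=> km th; pose s : R := - Num.sg (P`_k * P`_k.+1).
have ak : P`_k != 0 by rewrite -normr_gt0 a0// ltnW.
have ak1 : P`_k.+1 != 0 by rewrite -normr_gt0 a0.
have s1 : `|s| = 1 by rewrite normrN normr_sg mulf_neq0.
have s2 : s * s = 1 by rewrite -expr2 -real_normK ?num_real// s1 expr1n.
have sa : P`_k * P`_k.+1 * s < 0.
  by rewrite mulrN oppr_lt0 mulrC -normrEsg ?num_real// normr_gt0 mulf_neq0.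
have r0 := radius_ge0 _ (ltnW km); have r1 : 0 < radius P y k.+1 by exact: radius_gt0.
have := radius_le _ km.
set r := radius P y k in r0 *; set r' := radius P y k.+1 in r1 * => rr.
have rk : 0 < r ^+ k.
  have [->|k0] := posnP k; first by rewrite ltr01.
  by rewrite exprn_gt0// radius_gt0// k0 ltnW.
have nu : `|s * r| = r by rewrite normrM s1 mul1r ger0_norm.
have nv : `|s * r'| = r' by rewrite normrM s1 mul1r gtr0_norm.
have := sign_at_radius _ _ (ltnW km) nu (fun h => th k (introT andP (conj h (ltnW km)))).
have := sign_at_radius _ _ km nv (fun h => th k.+1 (introT andP (conj h km))).
move=> h1 h0; have {h0 h1} := mulr_ge0 h0 h1.
have -> : P`_k * (s * r) ^+ k * P.[s * r] *
    (P`_k.+1 * (s * r') ^+ k.+1 * P.[s * r']) =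
    (P`_k * P`_k.+1 * s) * (s * s) ^+ k * (r ^+ k * r' ^+ k.+1) *
    (P.[s * r] * P.[s * r']).
  by rewrite !exprMn !exprS; ring.
rewrite s2 expr1n mulr1 nmulr_rge0; last first.
  by rewrite nmulr_rlt0// mulr_gt0// exprn_gt0.
(* Passing to $Q(t) = P(st)$ moves the search to the positive half-axis for both values of [s]. *)
pose Q := P \Po (s *: 'X).
have QE t : Q.[t] = P.[s * t] by rewrite horner_comp !hornerE.
rewrite -!QE => PQ.
have [t rt Qt] : exists2 t, r <= t <= r' & root Q t.
  have [q0|q0] := leP Q.[r] 0.
    have [q1|q1] := leP 0 Q.[r']; first by apply: poly_ivt => //; rewrite q0.
    exists r; rewrite ?lexx// rootE eq_le q0 /=.
    by rewrite -(@nmulr_lle0 _ Q.[r']).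
  have [] := @poly_ivt _ (- Q) _ _ rr.
    by rewrite !hornerN !oppr_le0 oppr_ge0 (ltW q0) /= -(@pmulr_rle0 _ Q.[r]).
  by move=> t rt; rewrite rootN; exists t.
exists (s * t); rewrite normrM s1 mul1r ger0_norm; last first.
  by case/andP: rt => /(le_trans r0).
by rewrite rootE -QE.
Qed.

Lemma radius_mono i j : (i <= j <= m)%N -> radius P y i <= radius P y j.
Proof.
move=> /andP[/subnKC <-]; elim: (j - i)%N => [|e ih] h; first by rewrite addn0.
by rewrite (le_trans (ih _)) ?addnS ?radius_le//; lia.
Qed.

(** Zeros chosen in different annuli can coincide only on a shared circle. Strictness at [k] keeps
    zeros off circle [k]; the annulus with inner circle [k0] is dropped, which leaves at least
    [m - 1] distinct zeros. *)
Lemma all_zeros_real_of_theta k0 :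
  (forall i, (0 < i <= m)%N -> theta y i + theta y (m - i) <= 1) ->
  (forall i, (0 < i <= m)%N -> i != k0 -> theta y i + theta y (m - i) < 1) ->
  all_zeros_real P.
Proof.
move=> th th_lt.
have /boolp.choice[x xP] : forall k, exists x, (k < m)%N ->
    radius P y k <= `|x| <= radius P y k.+1 /\ root P x.
  move=> k; have [km|_] := boolP (k < m)%N; last by exists 0.
  by have [x ?] := annulus_zero _ km th; exists x.
have x_gt k : (k < m)%N -> k != k0 -> radius P y k < `|x k|.
  move=> km k0P; have [/andP[le1 _] rt] := xP k km.
  rewrite lt_neqAle le1 andbT; apply: contraTN rt => /eqP e.
  apply: (nonzero_at_radius k) => //; first exact: ltnW.
  by move=> k_gt0; apply: th_lt => //; rewrite k_gt0 ltnW.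
apply: (@all_zeros_real_of_roots _ _ [seq x k | k <- rem k0 (iota 0 m)]).
- by rewrite -size_poly_gt0; case: Pm => ->.
- rewrite map_inj_in_uniq ?rem_uniq ?iota_uniq// => i j.
  rewrite !mem_rem_uniq ?iota_uniq// !inE !mem_iota !add0n /=.
  move=> /andP[ik im] /andP[jk jm] e.
  wlog ij : i j ik im jk jm e / (i < j)%N.
    by case: (ltngtP i j) => // ij wl; [exact: wl|apply/esym/wl].
  have [/andP[_ le1] _] := xP i im.
  have := x_gt j jm jk; rewrite -e ltNge (le_trans le1)// radius_mono//.
  by rewrite ij ltnW.
- by apply/allP => _ /mapP[k /mem_rem + ->]; rewrite mem_iota => /xP[].
- case: Pm => -> _; rewrite size_map.
  have [k_in|k_out] := boolP (k0 \in iota 0 m).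
    by rewrite size_rem// size_iota; lia.
  by rewrite rem_id// size_iota.
Qed.
End DominantTerm.

(** * The bounds [b_even] in terms of theta sums, and criteria for real zeros *)

Section SignedTheta.
Context {R : realType}.
Implicit Types (P : {poly R}) (y : R).

(** With $y = x^{-1/2}$ one has $x^{-k^2/2} = y^{k^2}$. *)
Lemma b_eqn_theta n (x : R) : 0 < x ->
  b_eqn n x = 1 - theta (Num.sqrt x)^-1 n *+ 2.
Proof.
move=> x0; rewrite /b_eqn -[theta _ _ *+ 2]mulr_natl; congr (1 - _ * _).
rewrite -[n.+1]addn1 -[1%N in LHS]add0n big_addn addnK big_mkord.
apply: eq_bigr => i _.
rewrite addn1 powRN exprVn; congr (_^-1).
rewrite -natrX mulrC powRrM powR12_sqrt ?(ltW x0)//.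
by rewrite powR_mulrn ?sqrtr_ge0.
Qed.

Lemma theta_b_even n : (0 < n)%N ->
  theta (Num.sqrt (b_even R n))^-1 n *+ 2 = 1.
Proof.
move=> n0; have [b0 h] := b_evenP R n0.
by move: h; rewrite b_eqn_theta// => /subr0_eq.
Qed.

(** The first summand of the theta sum is $y$ itself and the whole sum is $1/2$. *)
Lemma inv_sqrt_b_even_lt1 n : (0 < n)%N ->
  0 < (Num.sqrt (b_even R n))^-1 < 1.
Proof.
move=> n0; have [b0 h] := b_evenP R n0.
have y0 : 0 < (Num.sqrt (b_even R n))^-1 by rewrite invr_gt0 sqrtr_gt0.
rewrite y0 /=; have := theta_b_even _ n0.
move: y0; set y := _^-1 => y0.
case: n n0 {b0 h} @y y0 => // n _ y y0.
rewrite /theta big_ord_recl /= expr1 mulr2n.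
have : 0 <= \sum_(i < n) y ^+ ((bump 0 i).+1 ^ 2).
  by apply: sumr_ge0 => i _; rewrite exprn_ge0// ltW.
lra.
Qed.

Lemma theta_gt_of_lt_b_even n (c : R) : (0 < n)%N -> 0 < c -> c < b_even R n ->
  1 < theta (Num.sqrt c)^-1 n *+ 2.
Proof.
move=> n0 c0 cb; have [b0 h] := b_evenP R n0.
by have := b_eqn_lt n0 c0 cb; rewrite h b_eqn_theta// subr_lt0.
Qed.

Lemma all_zeros_real_even n P : (0 < n)%N -> full_poly (2 * n) P ->
  (forall k : nat, (2 <= k <= 2 * n)%N ->
     b_even R n <= `|second_quotient P k|) ->
  all_zeros_real P.
Proof.
move=> n0 Pm Pq; have [b0 _] := b_evenP R n0.
have /andP[y0 y1] := inv_sqrt_b_even_lt1 _ n0.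
have th := theta_b_even _ n0.
apply: (@all_zeros_real_of_theta _ _ _ (2 * n) y0 y1 Pm _ n).
- move=> k /Pq h; rewrite exprVn sqr_sqrtr ?(ltW b0)// mulrC.
  by rewrite ler_pdivlMr// mul1r.
- move=> i /andP[_ im]; have [->|ni] := eqVneq i n.
    by rewrite (_ : 2 * n - n = n)%N -?mulr2n ?th//; lia.
  by rewrite -th ltW// theta_balanced.
- by move=> i /andP[_ im] ni; rewrite -th theta_balanced.
Qed.

Lemma all_zeros_real_odd n P : (0 < n)%N -> full_poly (2 * n + 1) P ->
  (forall k : nat, (2 <= k <= 2 * n + 1)%N ->
     b_even R (n + 1) <= `|second_quotient P k|) ->
  all_zeros_real P.
Proof.
move=> _ Pm Pq; have n0 : (0 < n + 1)%N by lia.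
have [b0 _] := b_evenP R n0.
have /andP[y0 y1] := inv_sqrt_b_even_lt1 _ n0.
have th := theta_b_even _ n0.
set y := _^-1 in y0 y1 th.
(* The sum for degree $2n+1$ lacks one positive term of the sum for degree $2n+2$, so strictness
   holds even at the central index $n+1$. *)
have lt1 i : (0 < i <= 2 * n + 1)%N -> theta y i + theta y (2 * n + 1 - i) < 1.
  move=> im.
  have : theta y (2 * n + 1 - i) < theta y (2 * (n + 1) - i).
    by apply: theta_lt => //; lia.
  have [->|ni] := eqVneq i (n + 1)%N.
    by rewrite (_ : 2 * (n + 1) - (n + 1) = n + 1)%N; [lra|lia].
  have : theta y i + theta y (2 * (n + 1) - i) < theta y (n + 1) *+ 2.
    by apply: theta_balanced => //; lia.
  lra.
apply: (@all_zeros_real_of_theta _ _ _ (2 * n + 1) y0 y1 Pm _ 0).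
- move=> k /Pq h; rewrite /y exprVn sqr_sqrtr ?(ltW b0)// mulrC.
  by rewrite ler_pdivlMr// mul1r.
- by move=> i /lt1/ltW.
- by move=> i /lt1.
Qed.

(** * Sharpness: polynomials with a single positive coefficient *)

Definition distpow y (n k : nat) : R := y ^+ ((n - k + (k - n)) ^ 2).

(** The degree [m] is independent of the centre [n], so that one family serves degrees $2n$ and
    $2n+1$. In [distpow], truncated subtraction makes [n - k + (k - n)] the distance $|n - k|$. *)
Definition signed_theta y (n m : nat) : {poly R} :=
  \poly_(k < m.+1) (if k == n then 1 else - distpow y n k).

(** The second difference of $(k-n)^2$ is the constant 2; hence all second quotients have the same
    absolute value. *)
Lemma distpow_sq y n k : y != 0 ->
  distpow y n k * distpow y n k.+2 = y ^+ 2 * distpow y n k.+1 ^+ 2.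
Proof.
move=> y0; rewrite /distpow -exprM -!exprD; congr (y ^+ _); nia.
Qed.

Lemma signed_theta_normcoef y n m k : 0 < y -> (k <= m)%N ->
  `|(signed_theta y n m)`_k| = distpow y n k.
Proof.
move=> y0 km; rewrite coef_poly ltnS km.
case: eqP => [->|_]; first by rewrite /distpow subnn normr1.
by rewrite normrN ger0_norm// exprn_ge0// ltW.
Qed.

Lemma signed_theta_full y n m : 0 < y -> full_poly m (signed_theta y n m).
Proof.
move=> y0; have nz k : (k <= m)%N -> (signed_theta y n m)`_k != 0.
  by move=> km; rewrite -normr_gt0 signed_theta_normcoef// exprn_gt0.
split => //; apply: size_poly_eq; have := nz m (leqnn m).
by rewrite coef_poly ltnS leqnn.
Qed.

Lemma signed_theta_quotient y n m k : 0 < y -> (2 <= k <= m)%N ->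
  `|second_quotient (signed_theta y n m) k| = y ^- 2.
Proof.
case: k => [|[|k]]// y0 km; rewrite /second_quotient /=.
rewrite normrM normrX normfV normrM !signed_theta_normcoef//; try by lia.
rewrite distpow_sq ?gt_eqF// invfM mulrCA divff ?mulr1//.
by rewrite expf_neq0// expf_neq0// gt_eqF.
Qed.

Lemma signed_theta_neg y n m x : 0 < y -> (2 * n <= m)%N ->
  1 < theta y n *+ 2 -> 0 < x -> (signed_theta y n m).[x] < 0.
Proof.
move=> y0 nm th x0; rewrite horner_poly.
rewrite -(big_mkord xpredT (fun k => (if k == n then 1 else - distpow y n k) * x ^+ k)).
rewrite (@big_cat_nat _ _ _ (2 * n).+1)//=.
(* Degrees above $2n$ have negative coefficients and only help; the rest is symmetric about [n]. *)
have h1 : \sum_((2 * n).+1 <= i < m.+1)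
    (if i == n then 1 else - distpow y n i) * x ^+ i <= 0.
  rewrite big_nat; apply: sumr_le0 => i im.
  have -> : (i == n) = false by apply/eqP; lia.
  by rewrite mulNr oppr_le0 mulr_ge0// exprn_ge0// ltW.
rewrite -[ltRHS]addr0 ltr_leD// {h1}.
rewrite (@big_cat_nat _ _ _ n)//=; [|by lia].
rewrite [X in _ + X]big_ltn; [|by lia].
rewrite eqxx mul1r [X in X + _](_ : _ =
    - \sum_(i < n) y ^+ (i.+1 ^ 2) * x ^+ (n - i.+1)); last first.
  rewrite big_mkord (reindex_inj rev_ord_inj) -sumrN; apply: eq_bigr => i _ /=.
  have im := ltn_ord i.
  have -> : (n - i.+1 == n)%N = false by apply/eqP; lia.
  by rewrite mulNr /distpow; congr (- (_ ^+ (_ ^ 2) * _)); lia.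
rewrite [X in _ + (_ + X)](_ : _ =
    - \sum_(i < n) y ^+ (i.+1 ^ 2) * x ^+ (n + i.+1)); last first.
  rewrite -[n.+1]add0n big_addn big_mkord -sumrN.
  rewrite (_ : ((2 * n).+1 - n.+1 = n)%N); last by lia.
  apply: eq_bigr => i _ /=.
  have -> : (i + n.+1 == n)%N = false by apply/eqP; lia.
  by rewrite mulNr /distpow; congr (- (_ ^+ (_ ^ 2) * _ ^+ _)); lia.
have key : theta y n *+ 2 * x ^+ n <=
    \sum_(i < n) y ^+ (i.+1 ^ 2) * x ^+ (n - i.+1) +
    \sum_(i < n) y ^+ (i.+1 ^ 2) * x ^+ (n + i.+1).
  rewrite -[theta _ _ *+ 2]mulr_natl /theta -big_split /= -mulrA mulr_suml mulr_sumr.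
  apply: ler_sum => i _; rewrite -mulrDr mulrCA ler_wpM2l ?exprn_ge0 ?(ltW y0)//.
  have im := ltn_ord i.
  have e : x ^+ n = x ^+ (n - i.+1) * x ^+ i.+1 by rewrite -exprD subnK.
  (* AM-GM for the pair of degrees $n \pm j$, with $j = i + 1$: $x^{n-j} + x^{n+j} - 2x^n =
     x^{n-j}(x^j - 1)^2$. *)
  rewrite exprD e -subr_ge0 (_ : _ - _ = x ^+ (n - i.+1) * (x ^+ i.+1 - 1) ^+ 2).
    by rewrite mulr_ge0 ?sqr_ge0// exprn_ge0// ltW.
  by ring.
have : x ^+ n < theta y n *+ 2 * x ^+ n by rewrite ltr_pMl// exprn_gt0.
lra.
Qed.

Lemma nonreal_zero_of_sign_change P k : (forall x : R, 0 < x -> ~~ root P x) ->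
  lead_coef P * P`_k < 0 -> has_nonreal_zero P.
Proof.
move=> Pn lk; apply: contrapT => h.
suff : all_zeros_real P.
  by move=> /coef_sign_of_real_zeros/(_ Pn) => /(_ k); rewrite leNgt lk.
move=> z rz; apply/negPn/negP => nz; apply: h; by exists z.
Qed.

Lemma sharp_even_bound n m (e : R) : (0 < n)%N -> (2 * n <= m)%N -> 0 < e ->
  exists P : {poly R},
    [/\ full_poly m P,
        forall k : nat, (2 <= k <= m)%N ->
          b_even R n - e < `|second_quotient P k|
      & has_nonreal_zero P].
Proof.
move=> n0 nm e0; have [b0 _] := b_evenP R n0.
(* The second entry keeps [c] positive when [e] is large. *)
pose c : R := Num.max (b_even R n - e / 2) (b_even R n / 2).
have c0 : 0 < c by rewrite lt_max divr_gt0 ?orbT.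
have cb : c < b_even R n by rewrite gt_max; lra.
have ce : b_even R n - e < c by rewrite lt_max; apply/orP; left; lra.
have y0 : 0 < (Num.sqrt c)^-1 by rewrite invr_gt0 sqrtr_gt0.
have th := theta_gt_of_lt_b_even _ _ n0 c0 cb.
exists (signed_theta (Num.sqrt c)^-1 n m); split.
- exact: signed_theta_full.
- move=> k km; rewrite signed_theta_quotient// -exprVn invrK.
  by rewrite sqr_sqrtr// ltW.
- apply: (@nonreal_zero_of_sign_change _ n) => [x x0|].
    by rewrite rootE lt_eqF// signed_theta_neg.
  have [sP _] := signed_theta_full _ n m y0.
  rewrite lead_coefE sP /= !coef_poly !ltnS leqnn eqxx.
  have -> : (m == n) = false by apply/eqP; lia.
  have -> : (n <= m)%N by lia.
  by rewrite mulr1 oppr_lt0 exprn_gt0.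
Qed.
End SignedTheta.

(** * Cubics *)

Section Cubic.
Context {R : realType}.
Implicit Types P : {poly R}.

(* A nonreal zero splits off a factor [X^2 + p X + q], and the discriminant of
   [(X^2 + p X + q) (s X + t)] is [p^2 - 4 q] times the square of the resultant
   of the two factors. *)
Lemma cubic_discr_neg P : size P = 4%N -> ~ all_zeros_real P ->
  P`_1 ^+ 2 * P`_2 ^+ 2 - 4 * P`_0 * P`_2 ^+ 3 - 4 * P`_1 ^+ 3 * P`_3
    + 18 * P`_0 * P`_1 * P`_2 * P`_3 - 27 * P`_0 ^+ 2 * P`_3 ^+ 2 < 0.
Proof.
move=> sP nr.
have [z [rz nz]] : has_nonreal_zero P.
  apply: contrapT => h; apply: nr => z rz; apply/negPn/negP => nz.
  by apply: h; exists z.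
have [p [q [pq QP]]] := nonreal_zero_factor _ _ _ rz nz.
set Q := _ + _ in QP.
have sQ : size Q = 3%N by exact: size_monic_quadratic.
have Q0 : Q != 0 by rewrite -size_poly_gt0 sQ.
have PE := divpK QP; set S := P %/ Q in PE.
have sS : size S = 2%N by rewrite size_divp// sP sQ.
have SE := poly_size_le2 _ S (eq_leq sS).
have s0 : S`_1 != 0.
  have : lead_coef S != 0 by rewrite lead_coef_eq0 -size_poly_gt0 sS.
  by rewrite lead_coefE sS.
move: S`_1 S`_0 s0 SE => s t s0 SE.
have {}PE : P = s *: 'X^3 + (s * p + t) *: 'X^2 + (s * q + t * p) *: 'X + (t * q)%:P.
  rewrite -PE SE /Q -!mul_polyC !rmorphD !rmorphM /=; ring.
have E0 : P`_0 = t * q.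
  by rewrite PE !coefD !coefZ !coefXn coefX coefC /= !mulr0 !add0r.
have E1 : P`_1 = s * q + t * p.
  by rewrite PE !coefD !coefZ !coefXn coefX coefC /= !mulr0 mulr1 !add0r addr0.
have E2 : P`_2 = s * p + t.
  by rewrite PE !coefD !coefZ !coefXn coefX coefC /= !mulr0 mulr1 !add0r !addr0.
have E3 : P`_3 = s.
  by rewrite PE !coefD !coefZ !coefXn coefX coefC /= !mulr0 mulr1 !addr0.
rewrite E0 E1 E2 E3.
rewrite [ltLHS](_ : _ =
    (p ^+ 2 - 4 * q) * (t ^+ 2 - s * t * p + s ^+ 2 * q) ^+ 2); last by ring.
rewrite nmulr_rlt0; last by lra.
apply: exprn_gt0.
(* Completing the square in [t] shows that the resultant is positive, as $s \ne 0$ and $p^2 <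
   4q$. *)
rewrite (_ : _ + _ =
    (t - s * p / 2) ^+ 2 + s ^+ 2 * ((4 * q - p ^+ 2) / 4)); last by field.
rewrite ltr_wpDl ?sqr_ge0// mulr_gt0//; first by rewrite lt_def sqrf_eq0 s0 sqr_ge0.
by lra.
Qed.

Let c : R := Num.sqrt (9 + 6 * Num.sqrt 3).

Lemma sqr_cubic_bound : c ^+ 2 = 9 + 6 * Num.sqrt 3.
Proof. by rewrite /c sqr_sqrtr// addr_ge0// mulr_ge0// sqrtr_ge0. Qed.

(** Ensures $1 - 4u > 0$ for $|u| \le 1/c$, the starting value of the linear interpolations
    below. *)
Lemma cubic_bound_gt4 : 4 < c.
Proof.
rewrite -(@ltr_pXn2r _ 2) ?nnegrE ?sqrtr_ge0// sqr_cubic_bound.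
have : 3 / 2 < Num.sqrt (3 : R).
  rewrite -(@ltr_pXn2r _ 2) ?nnegrE ?sqrtr_ge0 ?divr_ge0// sqr_sqrtr//; lra.
lra.
Qed.

(* [u] and [v] stand for the inverses of the two second quotients; dividing the
   discriminant by [P`_1 ^+ 2 * P`_2 ^+ 2] leaves this expression. *)
Lemma cubic_discr_ge0 (u v : R) : `|u| <= c^-1 -> `|v| <= c^-1 ->
  0 <= 1 - 4 * u - 4 * v + 18 * u * v - 27 * u ^+ 2 * v ^+ 2.
Proof.
have c4 := cubic_bound_gt4.
have c0 : 0 < c by lra.
have s0 : 0 < c^-1 by rewrite invr_gt0.
have s4 : c^-1 < 1 / 4 by rewrite ltr_pdivlMr// -ltr_pdivlMl// ?invrK ?mulr1; lra.
(* This is the expression at $u = 1/c$, $v = -1/c$: the extremal case has opposite signs, and the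
   value of [c] makes it vanish there. *)
have sE : 1 - 18 * c^-1 ^+ 2 - 27 * c^-1 ^+ 4 = 0.
  have e4 : c ^+ 4 = 18 * c ^+ 2 + 27.
    rewrite (_ : c ^+ 4 = (c ^+ 2) ^+ 2); last by ring.
    rewrite sqr_cubic_bound sqrrD exprMn sqr_sqrtr//; ring.
  apply: (mulfI (x := c ^+ 4)); first by rewrite expf_neq0 ?gt_eqF.
  rewrite mulr0 -[RHS](subrr (c ^+ 4)) {3}e4; field; by rewrite gt_eqF.
move: s0 s4 sE; set s := c^-1 => s0 s4 sE.
have linear_ge0 a b w : 0 <= w -> w <= s -> 0 <= a -> 0 <= a + s * b -> 0 <= a + w * b.
  move=> w0 ws a_ge0 ab.
  have [b0|b0] := leP 0 b; first by rewrite addr_ge0// mulr_ge0.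
  by rewrite (le_trans ab)// lerD2l ler_wnM2r// ltW.
have mixed x w : 0 <= x -> x <= s -> 0 <= w -> w <= s ->
    0 <= 1 - 4 * x + 4 * w - 18 * x * w - 27 * x ^+ 2 * w ^+ 2.
  move=> x0 xs w0 ws.
  (* The expression is concave in [w], so it lies above its chord on $[0, s]$, obtained by replacing
     $w^2$ with $sw$; the chord is checked at both ends. *)
  have : 0 <= (1 - 4 * x) + w * (4 - 18 * x - 27 * x ^+ 2 * s).
    apply: (linear_ge0 _ _ _) => //; first by lra.
    have : s * x <= s * s by rewrite ler_pM2l.
    have : (s * x) ^+ 2 <= (s * s) ^+ 2.
      by rewrite ler_pXn2r ?nnegrE ?mulr_ge0 ?(ltW s0)// ler_pM2l.
    move: sE; rewrite !exprMn; nra.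
  have : 0 <= 27 * x ^+ 2 * (w * (s - w)).
    by rewrite !mulr_ge0 ?sqr_ge0// subr_ge0.
  lra.
have pos x w : 0 <= x -> x <= s -> 0 <= w -> w <= s ->
    0 <= 1 - 4 * x - 4 * w + 18 * x * w - 27 * x ^+ 2 * w ^+ 2.
  move=> x0 xs w0 ws.
  have : 0 <= (1 - 4 * x) + w * (- 4 + 18 * x - 27 * x ^+ 2 * s).
    apply: (linear_ge0 _ _ _) => //; first by lra.
    (* The same chord argument in [x] at $w = s$; the corner $x = w = s$ gives $(1 - 3s)^3(1 +
       s)$. *)
    have : 0 <= (1 - 4 * s) + x * (- 4 + 18 * s - 27 * s ^+ 3).
      apply: (linear_ge0 _ _ _) => //; first by lra.
      rewrite [leRHS](_ : _ = (1 - 3 * s) ^+ 3 * (1 + s)); last by ring.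
      by rewrite mulr_ge0 ?exprn_ge0//; lra.
    have : 0 <= 27 * s ^+ 2 * (x * (s - x)).
      by rewrite !mulr_ge0 ?(ltW s0)// subr_ge0.
    lra.
  have : 0 <= 27 * x ^+ 2 * (w * (s - w)).
    by rewrite !mulr_ge0 ?sqr_ge0// subr_ge0.
  lra.
rewrite !ler_norml => /andP[u1 u2] /andP[v1 v2].
have [u0|u0] := leP 0 u; have [v0|v0] := leP 0 v.
- exact: pos.
- have := mixed u (- v) u0 u2; rewrite sqrrN; lra.
- have := mixed v (- u) v0 v2; rewrite sqrrN; lra.
(* With both negative, only $-27u^2v^2$ can be negative, and $27s^4 = 1 - 18s^2 \le 1$ bounds it. *)
have uv : 0 <= u * v by rewrite nmulr_rge0 ?ltW.
have uvs : u * v <= s * s.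
  by rewrite -mulrNN ler_pM ?oppr_ge0 ?(ltW u0) ?(ltW v0)//; lra.
have : (u * v) ^+ 2 <= (s * s) ^+ 2 by rewrite ler_pXn2r ?nnegrE ?uv ?mulr_ge0 ?(ltW s0).
have : 0 <= s ^+ 2 by exact: sqr_ge0.
move: sE; rewrite !exprMn; nra.
Qed.

Lemma all_zeros_real_cubic P : full_poly 3 P ->
  (forall k : nat, (2 <= k <= 3)%N -> c <= `|second_quotient P k|) ->
  all_zeros_real P.
Proof.
move=> [sP nz] Pq; apply: contrapT => /(cubic_discr_neg _ sP).
have := Pq 2%N isT; have := Pq 3%N isT; rewrite /second_quotient /=.
have := nz 0%N isT; have := nz 1%N isT; have := nz 2%N isT; have := nz 3%N isT.
move: P`_0 P`_1 P`_2 P`_3 => a0 a1 a2 a3 n3 n2 n1 n0.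
have c0 : 0 < c by have := cubic_bound_gt4; lra.
have inv (x : R) : c <= `|x| -> `|x^-1| <= c^-1.
  by move=> h; rewrite normfV lef_pV2// posrE// (lt_le_trans c0).
move=> /inv h3 /inv h2; have := cubic_discr_ge0 _ _ h2 h3.
set D := (X in 0 <= X); set E := (X in X < 0) => D0.
have -> : E = (a1 * a2) ^+ 2 * D.
  by rewrite /E /D; field; rewrite n0 n1 n2 n3.
by move=> lt0; have := mulr_ge0 (sqr_ge0 (a1 * a2)) D0; rewrite leNgt lt0.
Qed.

(** The claim reads $qt(1-t) < 1 + t^3$; it is immediate for $t \ge 1$, and for $t < 1$ it reduces
    to the weak inequality at $q = c$. *)
Lemma cubic_pos (q t : R) : 0 < t -> 0 < q -> q < c ->
  0 < 1 - q * t + q * t ^+ 2 + t ^+ 3.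
Proof.
move=> t0 q0 qc.
have [t1|t1] := leP 1 t.
  have : 0 <= q * t * (t - 1) by rewrite !mulr_ge0 ?(ltW q0) ?(ltW t0) ?subr_ge0.
  have : 0 < t ^+ 3 by rewrite exprn_gt0.
  lra.
have tt : 0 < t * (1 - t) by rewrite mulr_gt0// subr_gt0.
have c0 : 0 < c by lra.
have h : c * (t * (1 - t)) <= 1 + t ^+ 3.
  have h1 : 0 <= c * (t * (1 - t)) by rewrite mulr_ge0// ltW.
  have h2 : 0 <= 1 + t ^+ 3 by rewrite addr_ge0// exprn_ge0// ltW.
  rewrite -(@ler_pXn2r _ 2)//.
  (* At the critical [c] the cubic has a double zero [t]; the difference of
     squares is palindromic, and [t + t^-1 = 1 + sqrt 3] there. *)
  rewrite exprMn sqr_cubic_bound -subr_ge0.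
  have : Num.sqrt 3 ^+ 2 = 3 :> R by rewrite sqr_sqrtr.
  have : 0 <= Num.sqrt (3 : R) by rewrite sqrtr_ge0.
  move: (Num.sqrt _) => r r0 r3.
  have -> : (1 + t ^+ 3) ^+ 2 - (9 + 6 * r) * (t * (1 - t)) ^+ 2 =
     (t ^+ 2 - (1 + r) * t + 1) ^+ 2 * (t ^+ 2 + 2 * (1 + r) * t + 1).
    have e2 : r * r = 3 by rewrite -expr2.
    ring: e2.
  rewrite mulr_ge0 ?sqr_ge0// !addr_ge0 ?sqr_ge0// mulr_ge0 ?(ltW t0)// mulr_ge0//.
  by rewrite addr_ge0.
have : q * (t * (1 - t)) < c * (t * (1 - t)) by rewrite ltr_pM2r.
move: h; lra.
Qed.

Lemma sharp_cubic_bound (e : R) : 0 < e -> exists P,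
  [/\ full_poly 3 P,
      forall k : nat, (2 <= k <= 3)%N -> c - e < `|second_quotient P k|
    & has_nonreal_zero P].
Proof.
move=> e0; have c4 := cubic_bound_gt4.
pose q : R := Num.max (c - e / 2) (c / 2).
have q0 : 0 < q by rewrite lt_max; apply/orP; right; lra.
have qc : q < c by rewrite gt_max; apply/andP; split; lra.
have qe : c - e < q by rewrite lt_max; apply/orP; left; lra.
(* The second quotients are $q$ and $-q$, the opposite signs of the extremal case of the
   discriminant. *)
pose P := Poly [:: 1; - q; q; 1].
have PE : P = [:: 1; - q; q; 1] :> seq R by rewrite (@PolyK _ 0)//= oner_neq0.
exists P; split.
- split; first by rewrite PE.
  by move=> [|[|[|[|k]]]]// _; rewrite PE /= ?oppr_eq0 ?oner_neq0// gt_eqF.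
- move=> [|[|[|[|k]]]]// _; rewrite /second_quotient PE /=.
    by rewrite sqrrN mul1r expr2 mulfK ?gt_eqF// gtr0_norm.
  by rewrite mulr1 invrN mulrN normrN expr2 mulfK ?gt_eqF// gtr0_norm.
- apply: (@nonreal_zero_of_sign_change _ _ 1) => [t t0|].
    rewrite rootE /P horner_Poly /= gt_eqF//.
    have := cubic_pos _ _ t0 q0 qc; lra.
  by rewrite lead_coefE PE /= mul1r oppr_lt0.
Qed.
End Cubic.

Theorem theorem1p5 (R : realType) :
  (* (i) *)
  (forall (n : nat) (P : {poly R}), (0 < n)%N ->
     full_poly (2 * n) P ->
     (forall k : nat, (2 <= k <= 2 * n)%N ->
        b_even R n <= `|second_quotient P k|) ->
     all_zeros_real P) /\
  (* (ii) *)
  (forall (n : nat) (e : R), (0 < n)%N -> 0 < e ->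
     exists P : {poly R},
       [/\ full_poly (2 * n) P,
           forall k : nat, (2 <= k <= 2 * n)%N ->
             b_even R n - e < `|second_quotient P k|
         & has_nonreal_zero P]) /\
  (* (iii) *)
  (forall (n : nat) (P : {poly R}), (0 < n)%N ->
     full_poly (2 * n + 1) P ->
     (forall k : nat, (2 <= k <= 2 * n + 1)%N ->
        b_even R (n + 1) <= `|second_quotient P k|) ->
     all_zeros_real P) /\
  (* (iv) *)
  (forall (n : nat) (e : R), (0 < n)%N -> 0 < e ->
     exists P : {poly R},
       [/\ full_poly (2 * n + 1) P,
           forall k : nat, (2 <= k <= 2 * n + 1)%N ->
             b_even R n - e < `|second_quotient P k|
         & has_nonreal_zero P]) /\
  (* (v) *)
  (forall P : {poly R},
     full_poly 3 P ->
     (forall k : nat, (2 <= k <= 3)%N ->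
        Num.sqrt (9 + 6 * Num.sqrt 3) <= `|second_quotient P k|) ->
     all_zeros_real P) /\
  (* (vi) *)
  (forall e : R, 0 < e ->
     exists P : {poly R},
       [/\ full_poly 3 P,
           forall k : nat, (2 <= k <= 3)%N ->
             Num.sqrt (9 + 6 * Num.sqrt 3) - e < `|second_quotient P k|
         & has_nonreal_zero P]).
Proof.
split; first by move=> n P; exact: all_zeros_real_even.
split; first by move=> n e n0; exact: sharp_even_bound.
split; first by move=> n P; exact: all_zeros_real_odd.
split; first by move=> n e n0; apply: sharp_even_bound => //; rewrite leq_addr.
by split; [exact: all_zeros_real_cubic | exact: sharp_cubic_bound].
Qed.
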